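(* Let $m>1$ be an integer, let $(G_n)_{n\ge 2}$ be a sequence of random graphs following the linear de-preferential attachment model with parameter $m$, and let $d_i(n)$ be the degree of a fixed vertex $v_i$, $i\ge 1$. Then, as $n\to\infty$, $$\frac{d_i(n)}{m\log n}\longrightarrow 1\quad\text{in probability.}$$
   Context: Linear de-preferential attachment model with parameter $m>1$: $G_n$ is a multigraph with vertices $v_1,\dots,v_n$, and $d_i(n)$ is the degree of $v_i$ in $G_n$ (all incident edges and half-edges counted, with multiplicity). The process starts from $G_2$, consisting of two vertices $v_1,v_2$ joined by $m$ edges together with $m$ extra ''free'' edges (half-edges) attached to one of the two vertices, which count toward that vertex's degree; thus the degrees in $G_2$ are $m$ and $2m$. Given $G_n$ ($n\ge2$), a new vertex $v_{n+1}$ with $m$ half-edges $e_{n+1,1},\dots,e_{n+1,m}$ is added, and these are attached one after the other to vertices among $v_1,\dots,v_n$. Let $d_j(n+1,k)$, $k=0,\dots,m-1$, be the degree of $v_j$, $1\le j\le n$, after $k$ of the half-edges of $v_{n+1}$ have been attached, with $d_j(n+1,0)=d_j(n)$, and let $\mathscr{F}_{n+1,k}$ be the natural filtration of the process at that stage. Then for $j=1,\dots,n$ and $k=0,\dots,m-1$, $$P(e_{n+1,k+1}=\{v_j,v_{n+1}\}\mid\mathscr{F}_{n+1,k})=\frac{1}{n-1}\left(1-\frac{d_j(n+1,k)}{k+(2n-1)m}\right).$$ Each attachment raises the degree of the chosen vertex by one; $d_j(n+1)$, $j\le n$, is the degree of $v_j$ after all $m$ half-edges have been attached, and $d_{n+1}(n+1)=m$.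 *)

(* Defs.v *)
From HB Require Import structures.
From mathcomp Require Import all_boot all_order all_algebra.
From mathcomp Require Import all_classical all_reals all_analysis.

Set Implicit Arguments.
Unset Strict Implicit.
Unset Printing Implicit Defensive.

Import Order.TTheory GRing.Theory Num.Theory.
Import numFieldNormedType.Exports.

Local Open Scope classical_set_scope.
Local Open Scope ring_scope.

(* Vertex v_i is represented by the natural number i, starting from 1.
   Multiplicities are recorded by repetition in the lists. *)
Record multigraph := Multigraph {
  num_vertices : nat;         (* the vertices are 1, ..., num_vertices *)
  edges : seq (nat * nat);
  half_edges : seq nat        (* the vertex carrying each half-edge *)
}.

Definition degree (G : multigraph) (i : nat) : nat :=
  (\sum_(e <- edges G) ((e.1 == i) + (e.2 == i)) +
     count_mem i (half_edges G))%N.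

(* G_2, with the m free half-edges carried by the vertex a. *)
Definition initial_graph (m a : nat) : multigraph :=
  Multigraph 2 (nseq m (1%N, 2%N)) (nseq m a).

Definition add_vertex (m : nat) (G : multigraph) : multigraph :=
  Multigraph (num_vertices G).+1 (edges G)
    (nseq m (num_vertices G).+1 ++ half_edges G).

(* One half-edge of the most recent vertex is completed to an edge ending
   at j. *)
Definition attach (j : nat) (G : multigraph) : multigraph :=
  Multigraph (num_vertices G) ((j, num_vertices G) :: edges G)
    (rem (num_vertices G) (half_edges G)).

(* From a graph G with n vertices, the graph obtained by adding v_{n+1} and
   attaching k of its half-edges, the l-th one to the vertex c l. *)
Fixpoint partial_step (m : nat) (c : nat -> nat) (k : nat) (G : multigraph) :
    multigraph :=
  if k is l.+1 then attach (c l.+1) (partial_step m c l G)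
  else add_vertex m G.

(* G_n, where c n l is the vertex to which the l-th half-edge of v_n is
   attached (3 <= n, 1 <= l <= m). The values at n = 0, 1 are irrelevant. *)
Fixpoint graph_of (m a : nat) (c : nat -> nat -> nat) (n : nat) : multigraph :=
  if n is p.+1 then
    if (2 <= p)%N then partial_step m (c n) m (graph_of m a c p)
    else initial_graph m a
  else initial_graph m a.

Section Probability.
Context (d : measure_display) (T : measurableType d) (R : realType)
  (P : probability T R).

(* The function g is a version of the conditional probability of the event E
   given the sigma-algebra F, assumed to be contained in that of T. *)
Definition is_cond_prob (F : set (set T)) (E : set T) (g : T -> R) : Prop :=
  [/\ forall B : set R, measurable B -> F (g @^-1` B),
      P.-integrable setT (EFin \o g) &
      forall A, F A -> (\int[P]_(w in A) (g w)%:E = P (A `&` E))%E].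

Definition cvg_in_probability (X : nat -> T -> R) (Y : T -> R) : Prop :=
  forall eps : R, 0 < eps ->
    P [set w | eps < `|X n w - Y w|] @[n --> \oo] --> 0%E.

(* F_{n+1,k}: generated by the choice of the vertex carrying the free
   half-edges, by all attachments made by v_3, ..., v_n, and by the first k
   attachments made by v_{n+1}. *)
Definition history (m : nat) (a : {RV P >-> nat})
    (c : nat -> nat -> {RV P >-> nat}) (n k : nat) : set (set T) :=
  <<s g_sigma_algebra_preimage a `|`
      [set A | exists p l, [/\ (3 <= p)%N, (1 <= l)%N,
         ((p <= n) && (l <= m) || (p == n.+1) && (l <= k))%N &
         g_sigma_algebra_preimage (c p l) A]] >>.

Definition attachment_prob (m n k : nat) (dj : nat) : R :=
  (n.-1%:R)^-1 * (1 - dj%:R / (k + (2 * n - 1) * m)%:R).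

Definition de_preferential_attachment (m : nat) (G : nat -> T -> multigraph) :
    Prop :=
  exists (a : {RV P >-> nat}) (c : nat -> nat -> {RV P >-> nat}),
  [/\ forall w, a w = 1%N \/ a w = 2%N,
      forall n w, (2 <= n)%N ->
        G n w = graph_of m (a w) (fun p l => c p l w) n,
      forall n k w, (2 <= n)%N -> (k < m)%N -> (1 <= c n.+1 k.+1 w <= n)%N &
      forall n k j, (2 <= n)%N -> (k < m)%N -> (1 <= j <= n)%N ->
        is_cond_prob (history m a c n k) (c n.+1 k.+1 @^-1` [set j])
          (fun w => attachment_prob m n k
             (degree (partial_step m (fun l => c n.+1 l w) k (G n w)) j))].

End Probability.

(* Main.v *)
Require Import Defs.
From mathcomp Require Import all_boot all_order all_algebra.
From mathcomp Require Import all_classical all_reals all_analysis.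
From mathcomp Require Import zify ring lra.
Import Order.TTheory GRing.Theory Num.Theory.
Import numFieldNormedType.Exports.
Local Open Scope classical_set_scope.
Local Open Scope ring_scope.
Set Implicit Arguments.
Unset Strict Implicit.
Unset Printing Implicit Defensive.

(* Each half-edge of v_{n+1} raises X = d_i by one with conditional probability
   u (1 - X / D), where u = 1/(n-1) and D = k + (2n-1)m. Let a be the sum of
   all these u so far, which is m H_{n-2} + k/(n-1). Completing the square in X,
   one attachment increases E (X - a)^2 by at most
     u ((2a+1)^2 / (8D) + 2) <= (2m+2) u,
   because a^2 = O(log^2 n) = O(D). Summing, E (d_i(n) - m H_{n-2})^2 is
   O(log n), and Chebyshev's inequality concludes since
   |H_{n-2} - log n| <= 1. *)

(** * Degrees along a sequence of attachments *)

Lemma num_vertices_partial_step m c k G :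
  num_vertices (partial_step m c k G) = (num_vertices G).+1.
Proof. by elim: k => [|k IH]. Qed.

Lemma num_vertices_graph_of m a c n :
  (2 <= n)%N -> num_vertices (graph_of m a c n) = n.
Proof.
elim: n => [//|n IH] hn /=; case: ifP => h.
  by rewrite num_vertices_partial_step IH.
by case: n hn h {IH} => [|[|n]].
Qed.

Lemma degree_add_vertex m G i :
  degree (add_vertex m G) i = (degree G i + (i == (num_vertices G).+1) * m)%N.
Proof.
rewrite /degree /= count_cat count_nseq /= addnCA addnA addnC addnA.
by rewrite [(_ == i)]eq_sym; lia.
Qed.

(** The removed half-edge compensates the new endpoint at the newest vertex, so only [j] gains.
    Membership matters because [rem] does nothing when the element is absent. *)
Lemma degree_attach j G i : num_vertices G \in half_edges G ->
  degree (attach j G) i = (degree G i + (j == i))%N.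
Proof.
move=> h; rewrite /degree /= big_cons /=.
have /permP/(_ (pred1 i)) -> := perm_to_rem h.
by rewrite /=; lia.
Qed.

(** Each attachment uses up at most one of the [m] half-edges of the new vertex, so one is still
    available whenever [k < m]. *)
Lemma count_half_edges_partial_step m c k G :
  (m - k <= count_mem (num_vertices G).+1 (half_edges (partial_step m c k G)))%N.
Proof.
elim: k => [|k IH] /=; first by rewrite count_cat count_nseq /= eqxx; lia.
rewrite num_vertices_partial_step; case: (boolP ((num_vertices G).+1
    \in half_edges (partial_step m c k G))) => [h|h].
  have /permP/(_ (pred1 (num_vertices G).+1)) := perm_to_rem h.
  by rewrite /= eqxx => e; move: IH; rewrite e; lia.
by rewrite (rem_id h); apply: leq_trans IH; lia.
Qed.

Lemma degree_partial_stepS m c k G i : (k < m)%N ->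
  degree (partial_step m c k.+1 G) i =
    (degree (partial_step m c k G) i + (c k.+1 == i))%N.
Proof.
move=> hk; rewrite /= degree_attach// num_vertices_partial_step.
have := count_half_edges_partial_step m c k G.
by rewrite -has_pred1 has_count; lia.
Qed.

Lemma graph_ofS m a c n : (2 <= n)%N ->
  graph_of m a c n.+1 = partial_step m (c n.+1) m (graph_of m a c n).
Proof. by move=> /= ->. Qed.

(** * Harmonic sums compared with the logarithm *)

Section Harmonic.
Context {R : realType}.

Definition harmonic_sum (n : nat) : R := \sum_(j < n) j.+1%:R^-1.

Lemma harmonic_sumS n : harmonic_sum n.+1 = harmonic_sum n + n.+1%:R^-1.
Proof. by rewrite /harmonic_sum big_ord_recr. Qed.

Lemma harmonic_sum_ge0 n : 0 <= harmonic_sum n.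
Proof. by apply: sumr_ge0 => j _; rewrite invr_ge0. Qed.

Lemma harmonic_sum_le n : harmonic_sum n <= n%:R.
Proof.
elim: n => [|n IH]; first by rewrite /harmonic_sum big_ord0.
rewrite harmonic_sumS -natr1 lerD// natr1 invf_le1// ?ler1n//.
Qed.

(** With H_n <= n, the square grows by 2 H_n / (n+1) + 1/(n+1)^2 <= 3 per step. Linear growth
    suffices for a^2 = O(D). *)
Lemma harmonic_sum_sqr_le n : harmonic_sum n ^+ 2 <= 3 * n%:R.
Proof.
elim: n => [|n IH]; first by rewrite /harmonic_sum big_ord0 expr0n mulr0.
rewrite harmonic_sumS -natr1.
have := harmonic_sum_ge0 n; have := harmonic_sum_le n; have n0 := ler0n R n.
have : n.+1%:R * n.+1%:R^-1 = 1 :> R by rewrite mulfV.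
rewrite -natr1.
have : 0 < (n%:R + 1)^-1 :> R by rewrite invr_gt0; lra.
move: IH n0; set x := n%:R; set h := harmonic_sum n; set y := (_ + 1)^-1.
by move=> *; nra.
Qed.

(** The logarithm grows by ln (1 + 1/(n+1)) <= 1/(n+1). *)
Lemma harmonic_sum_ge_ln n : ln n.+1%:R <= harmonic_sum n.
Proof.
elim: n => [|n IH]; first by rewrite ln1 harmonic_sum_ge0.
rewrite harmonic_sumS.
have -> : n.+2%:R = n.+1%:R * (1 + n.+1%:R^-1) :> R.
  by rewrite mulrDr mulr1 mulfV// natr1.
by rewrite lnM ?posrE ?addr_gt0// lerD// le_ln1Dx// (lt_trans _ (_ : 0 < _)).
Qed.

(** The logarithm grows by -ln (1 - 1/(n+2)) >= 1/(n+2). *)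
Lemma harmonic_sum_le_ln n : harmonic_sum n.+1 <= 1 + ln n.+1%:R.
Proof.
elim: n => [|n IH].
  by rewrite harmonic_sumS /harmonic_sum big_ord0 add0r ln1 invr1 addr0.
rewrite harmonic_sumS.
have e : n.+1%:R = n.+2%:R * (1 + - n.+2%:R^-1) :> R.
  by rewrite mulrDr mulr1 mulrN mulfV// -[n.+2%:R]natr1; ring.
have hV : n.+2%:R^-1 < 1 :> R by rewrite invf_lt1// ltr1n.
have h : 0 < 1 + - n.+2%:R^-1 :> R by rewrite subr_gt0.
have -> : ln n.+2%:R = ln n.+1%:R - ln (1 + - n.+2%:R^-1) :> R.
  by rewrite e lnM ?posrE// addrK.
have /le_ln1Dx : -1 < - n.+2%:R^-1 :> R by rewrite ltrN2.
move: IH; set u := ln _; set v := ln _; set x := n.+2%:R^-1; set y := harmonic_sum _.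
by move=> IH hx; rewrite addrA lerD// lerNr.
Qed.

Lemma harmonic_sum_sub_ln n : `|harmonic_sum n - ln n.+2%:R| <= 1 :> R.
Proof.
have h1 : ln n.+2%:R <= harmonic_sum n + 1 :> R.
  rewrite (le_trans (harmonic_sum_ge_ln _))// harmonic_sumS lerD2l//.
  by rewrite invf_le1// ler1n.
have h2 : harmonic_sum n <= 1 + ln n.+2%:R :> R.
  have : harmonic_sum n <= harmonic_sum n.+1 :> R.
    by rewrite harmonic_sumS lerDl invr_ge0.
  move=> /le_trans; apply; rewrite (le_trans (harmonic_sum_le_ln _))// lerD2l.
  by rewrite ler_ln ?posrE// ler_nat.
by rewrite ler_norml; move: h1 h2; set u := harmonic_sum _; set v := ln _; lra.
Qed.

(* The quantity a of the header for n = p + 2; for p + 2 vertices the first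
   factor 1/(n-1) of the attachment probability is 1/(p+1). *)
Definition mean_approx (m p k : nat) : R :=
  m%:R * harmonic_sum p + k%:R / p.+1%:R.

Lemma mean_approx_ge0 m p k : 0 <= mean_approx m p k.
Proof. by rewrite addr_ge0// ?mulr_ge0// harmonic_sum_ge0. Qed.

(** This is the bound (2a+1)^2 <= 8 C D with C = 2m, as required to complete the square. *)
Lemma mean_approx_sqr_le m p k : (0 < m)%N -> (k <= m)%N ->
  (2 * mean_approx m p k + 1) ^+ 2 <=
  2 * m%:R * (8 * (k + (2 * p.+2 - 1) * m)%:R).
Proof.
move=> m0 km.
have h0 := harmonic_sum_ge0 p; have hs := harmonic_sum_sqr_le p.
have hm : mean_approx m p k <= m%:R * harmonic_sum p + m%:R.
  rewrite lerD2l ler_pdivrMr// (le_trans (_ : _ <= m%:R))// ?ler_nat//.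
  by rewrite ler_peMr// ler1n.
have ha := mean_approx_ge0 m p k.
have m1 : 1 <= m%:R :> R by rewrite ler1n.
have -> : (k + (2 * p.+2 - 1) * m)%:R = k%:R + (2 * p%:R + 3) * m%:R :> R.
  rewrite (_ : (2 * p.+2 - 1)%N = (2 * p + 3)%N); last by lia.
  by rewrite natrD natrM natrD natrM.
have k0 := ler0n R k; have p0 := ler0n R p.
move: hm ha hs h0 m1 k0 p0; set a := mean_approx _ _ _; set h := harmonic_sum p.
set M := m%:R; set K := k%:R; set x := p%:R => hm ha hs h0 m1 k0 p0.
apply: (@le_trans _ _ ((2 * M * (h + 2)) ^+ 2)).
  by rewrite lerXn2r ?nnegrE//; [lra|rewrite !mulr_ge0//; lra|nra].
(* Uses (h + 2)^2 <= 2 h^2 + 8, whose defect is (h - 2)^2, and then h^2 <= 3x. *)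
apply: (@le_trans _ _ (8 * M ^+ 2 * (3 * x + 4))).
  rewrite -subr_ge0 (_ : _ - _ =
    M ^+ 2 * (4 * (h - 2) ^+ 2 + 8 * (3 * x - h ^+ 2))); last by ring.
  apply: mulr_ge0; first exact: sqr_ge0.
  apply: addr_ge0; first by apply: mulr_ge0 => //; exact: sqr_ge0.
  by apply: mulr_ge0 => //; rewrite subr_ge0.
rewrite -subr_ge0 (_ : _ - _ = 16 * (M * K) + 8 * (M ^+ 2 * (x + 2)));
  last by ring.
by rewrite addr_ge0// ?mulr_ge0// ?sqr_ge0//; lra.
Qed.

Lemma mean_approxS m p k :
  mean_approx m p k.+1 = mean_approx m p k + p.+1%:R^-1.
Proof. by rewrite /mean_approx -natr1 mulrDl mul1r addrA. Qed.

Lemma mean_approx_full m p : mean_approx m p m = mean_approx m p.+1 0.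
Proof. by rewrite /mean_approx mul0r addr0 harmonic_sumS mulrDr. Qed.

End Harmonic.

(** * Level sets after adding an indicator *)

Lemma preimage_add_indicator (T : Type) (X : T -> nat) (E : set T) x :
  (fun w => X w + (w \in E))%N @^-1` [set x] =
  (X @^-1` [set x] `\` E) `|`
  (if x is y.+1 then X @^-1` [set y] `&` E else set0).
Proof.
apply/seteqP; split => w /=.
  case: (boolP (w \in E)) => [wE|wE].
    by rewrite addn1 => <-; right; split => //; rewrite -in_setE.
  by rewrite addn0 => ->; left; split => // /mem_set; exact/negP.
case=> [[<-]|].
  by move=> nE; rewrite memNset ?addn0.
by case: x => // x [/= <- wE]; rewrite mem_set ?addn1.
Qed.

Lemma measurable_add_indicator (d : measure_display) (T : measurableType d)
    (X : T -> nat) (E : set T) :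
  measurable E -> (forall x, measurable (X @^-1` [set x])) ->
  forall x, measurable ((fun w => X w + (w \in E))%N @^-1` [set x]).
Proof.
move=> mE mX x; rewrite preimage_add_indicator; apply: measurableU.
  exact: measurableD.
by case: x => [|x] //; exact: measurableI.
Qed.

(** * Laws of integer variables and second-moment estimates *)

Section Law.
Context (d : measure_display) (T : measurableType d) (R : realType)
  (P : probability T R).

Definition prob (A : set T) : R := fine (P A).

Definition law (X : T -> nat) (x : nat) : R := prob (X @^-1` [set x]).

Lemma probE A : measurable A -> P A = (prob A)%:E.
Proof. by move=> mA; rewrite fineK// fin_num_measure. Qed.

Lemma prob_ge0 A : 0 <= prob A.
Proof. exact/fine_ge0/measure_ge0. Qed.

Lemma prob_set0 : prob set0 = 0.
Proof. by rewrite /prob measure0. Qed.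

Lemma probU A B : measurable A -> measurable B -> A `&` B = set0 ->
  prob (A `|` B) = prob A + prob B.
Proof.
move=> mA mB AB; apply: EFin_inj; rewrite EFinD -!probE//.
  by rewrite measureU.
exact: measurableU.
Qed.

Lemma probDI A B : measurable A -> measurable B ->
  prob (A `\` B) = prob A - prob (A `&` B).
Proof.
move=> mA mB; apply/eqP; rewrite eq_sym subr_eq; apply/eqP.
rewrite -probU//; [|exact: measurableD|exact: measurableI|].
  by rewrite -setDDr setDv setD0.
by rewrite setDE setIACA setICl setI0.
Qed.

(** For bounded [X] this replaces expectations by finite sums over [law]. Measurability is carried
    through the induction because additivity needs it. *)
Lemma prob_finite_valued (X : T -> nat) (Q : pred nat) M :
  (forall x, measurable (X @^-1` [set x])) ->
  measurable [set w | (X w < M)%N && Q (X w)] /\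
  prob [set w | (X w < M)%N && Q (X w)] = \sum_(x < M | Q x) law X x.
Proof.
move=> mX; elim: M => [|M [mM IH]].
  rewrite big_ord0 (_ : [set _ | _] = set0) ?prob_set0//.
  by apply/seteqP; split.
have -> : [set w | (X w < M.+1)%N && Q (X w)] =
   [set w | (X w < M)%N && Q (X w)] `|`
   (if Q M then X @^-1` [set M] else set0).
  apply/seteqP; split => w /=.
    rewrite ltnS leq_eqVlt => /andP[/orP[/eqP XM|->] QX]; last by left.
    by right; rewrite -XM QX.
  case=> [/andP[h ->]|]; first by rewrite ltnS ltnW.
  by case: ifP => //= QM ->; rewrite ltnSn.
have mQ : measurable (if Q M then X @^-1` [set M] else set0).
  by case: ifP.
split; first exact: measurableU.
rewrite probU//.
  by rewrite big_mkcond big_ord_recr /= -big_mkcond IH; case: ifP;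
    rewrite ?prob_set0.
apply/seteqP; split => w //= [/andP[h _]].
by case: ifP => // _ /= e; rewrite e ltnn in h.
Qed.

Lemma law_add_indicator (X : T -> nat) (E : set T) x :
  measurable E -> (forall x, measurable (X @^-1` [set x])) ->
  law (fun w => X w + (w \in E))%N x =
    law X x - prob (X @^-1` [set x] `&` E) +
    (if x is y.+1 then prob (X @^-1` [set y] `&` E) else 0).
Proof.
move=> mE mX; rewrite -probDI// /law preimage_add_indicator.
rewrite probU.
- by case: x => [|x]; rewrite ?prob_set0.
- exact: measurableD.
- by case: x => [|x] //; exact: measurableI.
- apply/seteqP; split => w //= [[_ nE]].
  by case: x => // x [].
Qed.

(** The mass [q x * law X x] moves from level [x] to [x.+1], which changes the value of [f] by
    [f x.+1 - f x]. *)
Lemma sum_law_add_indicator (X : T -> nat) (E : set T) (q f : nat -> R) M :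
  measurable E -> (forall x, measurable (X @^-1` [set x])) ->
  (forall x, prob (X @^-1` [set x] `&` E) = q x * law X x) ->
  (forall w, X w < M)%N ->
  \sum_(x < M.+1) f x * law (fun w => X w + (w \in E))%N x =
  \sum_(x < M) (f x + (f x.+1 - f x) * q x) * law X x.
Proof.
move=> mE mX hq hM.
under eq_bigr do rewrite law_add_indicator// mulrDr.
rewrite big_split /= big_ord_recr /= hq.
(* [X] never reaches [M], so the extra top level only receives mass. *)
have -> : law X M = 0.
  rewrite /law (_ : X @^-1` _ = set0) ?prob_set0//.
  by apply/seteqP; split => w //= XM; have := hM w; rewrite XM ltnn.
rewrite mulr0 subrr mulr0 addr0 [X in _ + X]big_ord_recl /= mulr0 add0r.
rewrite -big_split; apply: eq_bigr => x _ /=.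
by rewrite !hq /=; ring.
Qed.

(* E (X - a)^2 <= B, for a bounded variable X. *)
Definition sq_dev_le (X : T -> nat) (a B : R) : Prop :=
  exists M, (forall w, X w < M)%N /\
    \sum_(x < M) (x%:R - a) ^+ 2 * law X x <= B.

Lemma sum_law (X : T -> nat) M :
  (forall x, measurable (X @^-1` [set x])) -> (forall w, X w < M)%N ->
  \sum_(x < M) law X x = 1.
Proof.
move=> mX hM; have [_ <-] := @prob_finite_valued X predT M mX.
rewrite (_ : [set _ | _] = setT) /prob ?probability_setT//.
by apply/seteqP; split => // w _ /=; rewrite hM.
Qed.

(** Chebyshev's inequality, term by term on the finite sum. *)
Lemma prob_dev_le (X : T -> nat) (a B eps : R) : 0 < eps ->
  (forall x, measurable (X @^-1` [set x])) -> sq_dev_le X a B ->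
  measurable [set w | eps < `|(X w)%:R - a|] /\
  prob [set w | eps < `|(X w)%:R - a|] <= B / eps ^+ 2.
Proof.
move=> eps0 mX [M [hM hB]].
have := @prob_finite_valued X (fun x => eps < `|x%:R - a|) M mX.
have -> : [set w | (X w < M)%N && (eps < `|(X w)%:R - a|)] =
   [set w | eps < `|(X w)%:R - a|].
  by apply/seteqP; split => w /=; rewrite hM.
case=> mA ->; split => //.
rewrite ler_pdivlMr ?exprn_gt0// (le_trans _ hB)// mulr_suml big_mkcond /=.
apply: ler_sum => x _; case: ifP => [h|_]; last first.
  by rewrite mulr_ge0 ?sqr_ge0// prob_ge0.
rewrite mulrC ler_wpM2r ?prob_ge0// -[leRHS]real_normK ?num_real//.
by rewrite lerXn2r ?nnegrE ?(ltW eps0)// ltW.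
Qed.

(* With [q x = u (1 - x / D)], completing the square in x bounds the growth
   of E (X - a)^2 when a is raised by u. *)
Lemma sq_dev_le_add_indicator (X : T -> nat) (E : set T) (a u D B C : R) :
  measurable E -> (forall x, measurable (X @^-1` [set x])) ->
  0 <= u <= 1 -> 0 < D -> (2 * a + 1) ^+ 2 <= C * (8 * D) ->
  (forall x, prob (X @^-1` [set x] `&` E) = u * (1 - x%:R / D) * law X x) ->
  sq_dev_le X a B ->
  sq_dev_le (fun w => X w + (w \in E))%N (a + u) (B + (C + 2) * u).
Proof.
move=> mE mX /andP[u0 u1] D0 hC hq [M [hM hB]]; exists M.+1; split.
  by move=> w; have := hM w; case: (w \in E) => /=; lia.
rewrite (@sum_law_add_indicator X E (fun x => u * (1 - x%:R / D))
  (fun x => (x%:R - (a + u)) ^+ 2))//.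
have -> : B + (C + 2) * u = B + (C + 2) * u * \sum_(x < M) law X x.
  by rewrite sum_law// mulr1.
rewrite (le_trans _ (lerD hB (lexx _)))// mulr_sumr -big_split /=.
apply: ler_sum => x _; rewrite -mulrDl ler_wpM2r ?prob_ge0//.
rewrite -natr1; set y := x%:R / D.
have xy : x%:R = y * D by rewrite /y divfK// gt_eqF.
have y0 : 0 <= y by rewrite divr_ge0// ltW.
(* As a quadratic in [y], the left side has maximum (2a+1)^2 / (8D). *)
have key : y * (2 * a + 1) - 2 * y ^+ 2 * D <= C.
  rewrite -(ler_pM2r (_ : 0 < 8 * D)) ?mulr_gt0// (le_trans _ hC)//.
  rewrite -subr_ge0 (_ : _ - _ = (2 * a + 1 - 4 * y * D) ^+ 2) ?sqr_ge0//.
  by ring.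
rewrite xy -subr_ge0.
(* Raising [a] by [u] cancels the drift term 2u(x - a); the rest is nonnegative by [key] and 0 <= u
   <= 1. *)
rewrite (_ : _ - _ = u * (C - (y * (2 * a + 1) - 2 * y ^+ 2 * D)
   + (1 - u) + 2 * (y * (1 - u) + u))); last by ring.
have yu : 0 <= y * (1 - u) by rewrite mulr_ge0// subr_ge0.
by apply: mulr_ge0 => //; lra.
Qed.

(** From (x-b)^2 <= 2(x-a)^2 + 2(a-b)^2. It serves to move the centre from a harmonic sum to a
    logarithm. *)
Lemma sq_dev_le_center (X : T -> nat) (a b B : R) :
  (forall x, measurable (X @^-1` [set x])) -> sq_dev_le X a B ->
  sq_dev_le X b (2 * B + 2 * (a - b) ^+ 2).
Proof.
move=> mX [M [hM hB]]; exists M; split => //.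
have -> : 2 * B + 2 * (a - b) ^+ 2 =
    2 * B + 2 * (a - b) ^+ 2 * \sum_(x < M) law X x.
  by rewrite sum_law// mulr1.
apply: (le_trans _ (lerD (ler_wpM2l _ hB) (lexx _))) => //.
rewrite !mulr_sumr -big_split /=.
apply: ler_sum => x _; rewrite mulrA -mulrDl ler_wpM2r ?prob_ge0//.
rewrite -subr_ge0 (_ : _ - _ = (x%:R - 2 * a + b) ^+ 2) ?sqr_ge0//.
by ring.
Qed.

(** The conditional probability is constant on a level set of [X], so its integral over that event
    of [F] is a product. *)
Lemma cond_prob_law (F : set (set T)) (E : set T) (q : nat -> R)
    (X : T -> nat) x :
  is_cond_prob P F E (fun w => q (X w)) ->
  F (X @^-1` [set x]) -> measurable (X @^-1` [set x]) ->
  prob (X @^-1` [set x] `&` E) = q x * law X x.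
Proof.
move=> [_ _ h] FX mX; rewrite /prob -(h _ FX).
rewrite (@eq_integral _ _ _ P _ (cst (q x)%:E)); last first.
  by move=> w /set_mem /= ->.
by rewrite integral_cst// fineM// fin_num_measure.
Qed.

(** * Events determined by the history *)

Context (m : nat) (a : {RV P >-> nat}) (c : nat -> nat -> {RV P >-> nat}).

Lemma history_measurable n k A : history m a c n k A -> measurable A.
Proof.
move: A; apply: smallest_sub; first exact: sigma_algebra_measurable.
move=> A [[B mB <-]|[p [l [_ _ _ [B mB <-]]]]]; rewrite setTI.
  by rewrite -[_ @^-1` _]setTI; exact: measurable_funP.
by rewrite -[_ @^-1` _]setTI; exact: measurable_funP.
Qed.

Lemma history_sub n k n' k' :
  (forall p l, (p <= n) && (l <= m) || (p == n.+1) && (l <= k) ->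
     (p <= n') && (l <= m) || (p == n'.+1) && (l <= k'))%N ->
  history m a c n k `<=` history m a c n' k'.
Proof.
move=> h; apply: sub_sigma_algebra2 => A [|[p [l [hp hl hpl hA]]]]; first by left.
by right; exists p, l; split => //; apply: h.
Qed.

Lemma history_init n k B : history m a c n k (a @^-1` B).
Proof.
by apply: sub_sigma_algebra; left; exists B => //; rewrite setTI.
Qed.

Lemma history_attachment n k j : (2 <= n)%N ->
  history m a c n k.+1 (c n.+1 k.+1 @^-1` [set j]).
Proof.
move=> hn; apply: sub_sigma_algebra; right; exists n.+1, k.+1; split => //.
  by rewrite eqxx leqnn orbT.
by exists [set j] => //; rewrite setTI.
Qed.

(** This is [measurable_add_indicator] with the history as sigma-algebra on [T]. *)
Lemma history_add_indicator n k (X : T -> nat) (E : set T) :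
  history m a c n k E -> (forall x, history m a c n k (X @^-1` [set x])) ->
  forall x, history m a c n k ((fun w => X w + (w \in E))%N @^-1` [set x]).
Proof. exact: (@measurable_add_indicator _ (g_sigma_algebraType (_ `|` _))). Qed.

Lemma history_add_const n k (X : T -> nat) b :
  (forall x, history m a c n k (X @^-1` [set x])) ->
  forall x, history m a c n k ((fun w => X w + b)%N @^-1` [set x]).
Proof.
move=> hX x; have [bx|xb] := leqP b x.
  rewrite (_ : _ @^-1` _ = X @^-1` [set (x - b)%N])//.
  by apply/seteqP; split => w /=; lia.
rewrite (_ : _ @^-1` _ = set0); first exact: sigma_algebra0.
by apply/seteqP; split => w //=; lia.
Qed.

End Law.

(** * The degree process: boundedness and adaptedness *)

Section Degree.
Context (d : measure_display) (T : measurableType d) (R : realType)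
  (P : probability T R).
Context (m : nat) (a : {RV P >-> nat}) (c : nat -> nat -> {RV P >-> nat})
  (i : nat).

(* d_i(n+1, k) in the paper; it is also meaningful for i = n+1 (the initial
   degree m) and is 0 for i > n+1. *)
Definition deg (n k : nat) (w : T) : nat :=
  degree (partial_step m (fun l => c n.+1 l w) k
    (graph_of m (a w) (fun p l => c p l w) n)) i.

Lemma degS n k : (k < m)%N -> deg n k.+1 =
  (fun w => deg n k w + (w \in c n.+1 k.+1 @^-1` [set i]))%N.
Proof.
move=> km; apply/funext => w; rewrite /deg degree_partial_stepS//; congr addn.
by congr nat_of_bool; apply/idP/idP => [/eqP ?|/set_mem /= ->//]; apply/mem_set.
Qed.

Lemma deg_next_vertex n : (2 <= n)%N ->
  deg n.+1 0 = (fun w => deg n m w + (i == n.+2) * m)%N.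
Proof.
move=> hn; apply/funext => w.
rewrite {1}/deg degree_add_vertex num_vertices_graph_of ?leqW//.
by rewrite graph_ofS.
Qed.

Lemma deg0 n w : (2 <= n)%N -> (i <= n)%N ->
  deg n 0 w = degree (graph_of m (a w) (fun p l => c p l w) n) i.
Proof.
move=> hn hi; rewrite /deg /= degree_add_vertex num_vertices_graph_of//.
by rewrite ltn_eqF// addn0.
Qed.

Lemma deg_bounded p k : (k <= m)%N ->
  exists M, forall w, (deg p.+2 k w < M)%N.
Proof.
elim: p k => [|p IHp]; elim=> [|k IHk] km.
(* A crude bound, uniform in [a w]: [3 * m] for the initial graph and [m] more in case [i] is the
   vertex being added. *)
- exists (3 * m + m).+1 => w; rewrite ltnS.
  rewrite /deg /= degree_add_vertex leq_add//; last by case: (_ == _); lia.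
  rewrite /degree /= big_nseq iter_addn_0 count_nseq.
  by case: (1%N == i); case: (2%N == i); case: (pred1 _ _) => /=; lia.
- have [M hM] := IHk (ltnW km); exists M.+1 => w; rewrite degS//.
  by have := hM w; case: (_ \in _); lia.
- have [M hM] := IHp m (leqnn m); exists (M + m)%N => w.
  by rewrite deg_next_vertex//; have := hM w; case: (_ == _); lia.
- have [M hM] := IHk (ltnW km); exists M.+1 => w; rewrite degS//.
  by have := hM w; case: (_ \in _); lia.
Qed.

Lemma deg_history p k x : (k <= m)%N ->
  history m a c p.+2 k (deg p.+2 k @^-1` [set x]).
Proof.
elim: p k x => [|p IHp] k x.
  elim: k x => [|k IHk] x km.
    (* Before any attachment the degree is a function of [a] alone. *)
    pose D b := degree (add_vertex m (initial_graph m b)) i.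
    exact: (@history_init _ _ _ _ _ _ _ _ _ (D @^-1` [set x])).
  rewrite degS//; apply: history_add_indicator; first exact: history_attachment.
  move=> y; apply: (@history_sub _ _ _ _ _ _ _ 2 k); last by apply: IHk; exact: ltnW.
  by move=> q l; lia.
elim: k x => [|k IHk] x km.
  rewrite deg_next_vertex//; apply: history_add_const => y.
  apply: (@history_sub _ _ _ _ _ _ _ p.+2 m); last exact: IHp.
  by move=> q l; lia.
rewrite degS//; apply: history_add_indicator; first exact: history_attachment.
move=> y; apply: (@history_sub _ _ _ _ _ _ _ p.+3 k); last by apply: IHk; exact: ltnW.
by move=> q l; lia.
Qed.

Lemma deg_measurable p k x : (k <= m)%N -> measurable (deg p.+2 k @^-1` [set x]).
Proof. by move=> km; apply: history_measurable; exact: deg_history. Qed.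

(** * Second-moment recursion for the degree *)

Section Recursion.
Context (m0 : (0 < m)%N) (cond_prob : forall n k,
  (2 <= n)%N -> (k < m)%N -> (i <= n)%N ->
  is_cond_prob P (history m a c n k) (c n.+1 k.+1 @^-1` [set i])
    (fun w => attachment_prob R m n k (deg n k w))).

Lemma sq_dev_le_degS p k B : (k < m)%N -> (i <= p.+2)%N ->
  sq_dev_le P (deg p.+2 k) (mean_approx m p k) B ->
  sq_dev_le P (deg p.+2 k.+1) (mean_approx m p k.+1)
    (B + (2 * m%:R + 2) / p.+1%:R).
Proof.
move=> km ip hB; rewrite degS// mean_approxS.
apply: (@sq_dev_le_add_indicator _ _ _ _ _ _ _ _ (k + (2 * p.+2 - 1) * m)%:R) => //.
- by rewrite -[_ @^-1` _]setTI; exact: measurable_funP.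
- by move=> x; apply: deg_measurable; exact: ltnW.
- by rewrite invr_ge0 ler0n invf_le1// ler1n.
- by rewrite ltr0n; nia.
- by apply: mean_approx_sqr_le => //; exact: ltnW.
move=> x; apply: (@cond_prob_law _ _ _ _ _ _ (attachment_prob R m p.+2 k)).
- exact: cond_prob.
- by apply: deg_history; exact: ltnW.
- by apply: deg_measurable; exact: ltnW.
Qed.

(** Each attachment raises the centre by u and the bound by (2m+2)u, so the accumulated bound is a
    multiple of the centre plus an initial constant. *)
Lemma sq_dev_le_deg : exists B, 0 <= B /\ forall p, (i <= p.+2)%N ->
  sq_dev_le P (deg p.+2 0) (m%:R * harmonic_sum p)
    (B + (2 * m%:R + 2) * (m%:R * harmonic_sum p)).
Proof.
have mean0 p : m%:R * harmonic_sum p = mean_approx m p 0 :> R.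
  by rewrite /mean_approx mul0r addr0.
(* The recursion starts with max(i, 2) vertices, the first graph containing [i]; truncated
   subtraction gives [i - 2 = 0] for [i = 1]. *)
have [M hM] := deg_bounded (i - 2) (leq0n m).
pose B : R := \sum_(x < M) (x%:R - mean_approx m (i - 2) 0) ^+ 2 *
  law P (deg (i - 2).+2 0) x.
have B0 : 0 <= B by apply: sumr_ge0 => x _; rewrite mulr_ge0 ?sqr_ge0 ?prob_ge0.
exists B; split => // p ip; rewrite mean0.
have -> : p = (i - 2 + (p - (i - 2)))%N by lia.
elim: (p - (i - 2))%N => [|s IHs].
  rewrite addn0; exists M; split => //.
  by rewrite lerDl mulr_ge0// ?mean_approx_ge0// addr_ge0// mulr_ge0.
rewrite addnS -mean_approx_full.
(* Past the start, the vertex being added is never [i]. *)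
have -> : deg (i - 2 + s).+3 0 = deg (i - 2 + s).+2 m.
  apply/funext => w; rewrite deg_next_vertex// (_ : _ == _ = false) ?addn0//.
  by lia.
suff : forall k, (k <= m)%N ->
    sq_dev_le P (deg (i - 2 + s).+2 k) (mean_approx m (i - 2 + s) k)
    (B + (2 * m%:R + 2) * mean_approx m (i - 2 + s) k) by apply.
elim=> [//|k IHk] km.
rewrite [X in _ + _ * X]mean_approxS mulrDr addrA.
by apply: sq_dev_le_degS => //; [lia|by apply: IHk; exact: ltnW].
Qed.

End Recursion.
End Degree.

(** * Convergence in probability from the second-moment bound *)

Theorem theorem2p5 (d : measure_display) (T : measurableType d) (R : realType)
    (P : probability T R) (m : nat) (hm : (1 < m)%N)
    (G : nat -> T -> multigraph) (hG : de_preferential_attachment P m G)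
    (i : nat) (hi : (1 <= i)%N) :
  cvg_in_probability P
    (fun n w => (degree (G n w) i)%:R / (m%:R * ln (n%:R : R)))
    (fun _ => 1).
Proof.
case: hG => a [c [_ GE _ cond]] eps eps0.
have m0 : (0 < m)%N by exact: ltnW.
have cond_prob n k : (2 <= n)%N -> (k < m)%N -> (i <= n)%N ->
  is_cond_prob P (history m a c n k) (c n.+1 k.+1 @^-1` [set i])
    (fun w => attachment_prob R m n k (deg m a c i n k w)).
  move=> hn hk hin; have := cond n k i hn hk; rewrite hi hin => /(_ erefl).
  by under eq_fun do rewrite GE//.
have [B [B0 hB]] := sq_dev_le_deg m0 cond_prob.
have m0R : 0 < m%:R :> R by rewrite ltr0n.
(* With l = log n >= 1, the second moment about m l is at most A l, and Chebyshev's bound A l / (eps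
   m l)^2 equals C / l. *)
pose A : R := 2 * (B + (2 * m%:R + 2) * (2 * m%:R)) + 2 * m%:R ^+ 2.
pose C := A / (eps * m%:R) ^+ 2.
have C0 : 0 <= C.
  by rewrite divr_ge0 ?sqr_ge0// addr_ge0 ?mulr_ge0 ?addr_ge0 ?mulr_ge0.
have relative_dev (y L : R) : 0 < L -> `|y / L - 1| = `|y - L| / L.
  by move=> L0; rewrite -{3}(gtr0_norm L0) -normf_div mulrBl divff ?gt_eqF.
have bound p : (i <= p.+2)%N -> 1 <= ln (p.+2%:R : R) ->
    (0 <= P [set w | (eps < `|(degree (G p.+2 w) i)%:R / (m%:R * ln p.+2%:R) - 1|)%R]
     <= (C / ln p.+2%:R)%:E)%E.
  move=> ip l1; rewrite measure_ge0/=.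
  set l := ln _ in l1 *.
  have l0 : 0 < l by rewrite (lt_le_trans ltr01).
  have L0 : 0 < m%:R * l by rewrite mulr_gt0.
  pose X := deg m a c i p.+2 0.
  have -> : [set w | eps < `|(degree (G p.+2 w) i)%:R / (m%:R * l) - 1|] =
      [set w | eps * (m%:R * l) < `|(X w)%:R - m%:R * l|].
    apply/seteqP; split => w /=;
      by rewrite /X deg0// GE// relative_dev// ltr_pdivlMr.
  have mX x : measurable (X @^-1` [set x]) by exact: deg_measurable.
  have hX := sq_dev_le_center (m%:R * l) mX (hB p ip).
  have [|mA hA] := prob_dev_le (eps := eps * (m%:R * l)) _ mX hX.
    by rewrite mulr_gt0.
  rewrite probE// lee_fin (le_trans hA)//.
  (* H_p <= l + 1 and 1 <= l. *)
  have hs : harmonic_sum p <= 2 * l.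
    by have := @harmonic_sum_sub_ln R p; rewrite -/l ler_norml => /andP[_]; lra.
  have hd : (m%:R * harmonic_sum p - m%:R * l) ^+ 2 <= m%:R ^+ 2.
    rewrite -mulrBr exprMn ler_piMr ?sqr_ge0// -real_normK ?num_real//.
    by rewrite exprn_ile1// harmonic_sum_sub_ln.
  rewrite /C; set e := eps * m%:R.
  have -> : (eps * (m%:R * l)) ^+ 2 = e ^+ 2 * l ^+ 2 by rewrite /e; ring.
  rewrite ler_pdivrMr ?mulr_gt0 ?exprn_gt0 ?mulr_gt0//.
  rewrite [leRHS](_ : _ = A * l); last first.
    by field; rewrite !gt_eqF// mulr_gt0.
  rewrite /A.
  (* The constants [B] and m^2 are absorbed into multiples of [l] using 1 <= l. *)
  have h1 := ler_wpM2l B0 l1.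
  have h2 := ler_wpM2l (sqr_ge0 m%:R) l1.
  have h3 : (2 * m%:R + 2) * (m%:R * harmonic_sum p) <=
      (2 * m%:R + 2) * (m%:R * (2 * l)).
    by rewrite ler_wpM2l ?addr_ge0 ?mulr_ge0// ler_wpM2l.
  by lra.
have ln_large (x : R) : \forall n \near \oo, x < ln n%:R.
  near=> n; rewrite -[x]expRK ltr_ln ?posrE ?expR_gt0//.
    by near: n; exact: nbhs_infty_gtr.
  by rewrite ltr0n; near: n; exact: nbhs_infty_gt.
apply: (squeeze_cvge (f := cst 0%E) (h := fun n => (C / ln n%:R)%:E)).
- near=> n.
  have -> : n = (n - 2).+2 by rewrite -addn2 subnK//; near: n; exact: nbhs_infty_ge.
  apply: bound; rewrite -addn2 subnK; try by near: n; exact: nbhs_infty_ge.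
  by apply: ltW; near: n; exact: ln_large.
- exact: cvg_cst.
- apply: cvg_EFin; first exact: nearW.
  apply/cvgr0Pnorm_lt => e e0; near=> n; rewrite /=.
  have hn : 0 < ln n%:R :> R by near: n; exact: ln_large.
  rewrite ger0_norm; last exact: (divr_ge0 C0 (ltW hn)).
  rewrite ltr_pdivrMr// mulrC -ltr_pdivrMr//.
  by near: n; exact: ln_large.
Unshelve. all: by end_near.
Qed.
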